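(* Let $\Lambda$ be a rank-$3$ lattice in $\mathbb{E}^3$. If $\Lambda$ is preserved by $\tilde{\mathbf{D}}_6$, then there exists a diagonal transformation $D=\mathrm{diag}(a,a,b)$ such that $$\Lambda D^{-1}\in\left\{\Lambda^{\{3,6\}}_{(1,0)}\oplus e_3,\ \Lambda^{\{3,6\}}_{(1,1)}\oplus e_3\right\}.$$
   Context: A rank-$d$ lattice is the set of integer linear combinations of $d$ linearly independent vectors of $\mathbb{E}^3$. $\{e_1,e_2,e_3\}$ is the standard basis, $u_1=e_1$ and $u_2=\frac12e_1+\frac{\sqrt3}{2}e_2$. $\tilde{\mathbf{D}}_6$ is the group of order $12$ generated by two reflections in planes containing the $z$-axis and meeting at angle $\frac{\pi}{6}$, one of the planes being $x=0$. A lattice is preserved by a group of linear isometries if every element of the group maps the lattice to itself. $\Lambda T=\{vT:v\in\Lambda\}$ for a linear map $T$; $\mathrm{diag}(a,a,b)$ is invertible. $\Lambda^{\{3,6\}}_{(1,0)}$ is the rank-$2$ lattice generated by $u_1,u_2$ and $\Lambda^{\{3,6\}}_{(1,1)}$ is the rank-$2$ lattice generated by $u_1+u_2$ and $2u_1-u_2$. For a lattice $\Lambda_0$ in a subspace $V$ and a vector $w\notin V$, $\Lambda_0\oplus w=\bigcup_{k\in\mathbb{Z}}(\Lambda_0+kw)$. *)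

(* Defs.v *)
From mathcomp Require Import all_boot all_order all_algebra.
From mathcomp Require Import classical_sets reals trigo.
Set Implicit Arguments. Unset Strict Implicit. Unset Printing Implicit Defensive.
Import Order.TTheory GRing.Theory Num.Theory.
Local Open Scope classical_set_scope.
Local Open Scope ring_scope.

(* Points of E^3 are row vectors, and linear maps are matrices acting on the
   right, so that v T is [v *m T]. *)

Definition vec3 (R : pzRingType) (x y z : R) : 'rV[R]_3 :=
  \row_j nth 0 [:: x; y; z] j.

Definition diag3 (R : pzRingType) (x y z : R) : 'M[R]_3 :=
  diag_mx (vec3 x y z).

Definition intspan (R : realType) (d : nat) (b : d.-tuple 'rV[R]_3) :
    set 'rV[R]_3 :=
  [set v | inIntSpan b v].

Definition is_lattice (R : realType) (d : nat) (L : set 'rV[R]_3) : Prop :=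
  exists2 b : d.-tuple 'rV[R]_3, free b & L = intspan b.

Definition lattice_map (R : realType) (L : set 'rV[R]_3) (T : 'M[R]_3) :
    set 'rV[R]_3 :=
  [set v *m T | v in L].

Definition preserved_by (R : realType) (L : set 'rV[R]_3)
    (G : set 'M[R]_3) : Prop :=
  forall g : 'M[R]_3, G g -> lattice_map L g = L.

Definition lattice_oplus (R : realType) (L0 : set 'rV[R]_3) (w : 'rV[R]_3) :
    set 'rV[R]_3 :=
  \bigcup_(k in [set: int]) [set v + w *~ k | v in L0].

Inductive generated_group (R : realType) (S : set 'M[R]_3) :
    'M[R]_3 -> Prop :=
  | generated_in g : S g -> generated_group S g
  | generated1 : generated_group S 1
  | generatedM g h : generated_group S g -> generated_group S h ->
      generated_group S (g * h)
  | generatedV g : generated_group S g -> generated_group S g^-1.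

(* The reflection v |-> v - 2 (v . n) / (n . n) n in the plane through the
   origin with normal vector n. *)
Definition reflection (R : realType) (n : 'rV[R]_3) : 'M[R]_3 :=
  1%:M - (2 / (n *m n^T) 0 0) *: (n^T *m n).

Definition e1 (R : realType) : 'rV[R]_3 := vec3 1 0 0.
Definition e2 (R : realType) : 'rV[R]_3 := vec3 0 1 0.
Definition e3 (R : realType) : 'rV[R]_3 := vec3 0 0 1.

Definition u1 (R : realType) : 'rV[R]_3 := e1 R.
Definition u2 (R : realType) : 'rV[R]_3 :=
  2^-1 *: e1 R + (Num.sqrt 3 / 2) *: e2 R.

(* The plane x = 0 has normal e1; a plane containing the z-axis and meeting it
   at angle pi/6 has normal (cos (pi/6), sin (pi/6), 0).  The only other such
   plane, with normal (cos (pi/6), - sin (pi/6), 0), is its mirror image in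
   x = 0, so it yields the same group. *)
Definition D6tilde (R : realType) : set 'M[R]_3 :=
  generated_group
    [set reflection (e1 R);
         reflection (vec3 (cos (pi / 6)) (sin (pi / 6)) 0)].

Definition Lambda36_10 (R : realType) : set 'rV[R]_3 :=
  intspan [tuple u1 R; u2 R].

Definition Lambda36_11 (R : realType) : set 'rV[R]_3 :=
  intspan [tuple u1 R + u2 R; 2 *: u1 R - u2 R].

Arguments D6tilde R : clear implicits.
Arguments Lambda36_10 R : clear implicits.
Arguments Lambda36_11 R : clear implicits.

(* Main.v *)
Require Import Defs.
From mathcomp Require Import all_boot all_order all_algebra.
From mathcomp Require Import classical_sets reals trigo.
From mathcomp Require Import boolp ring lra zify.
Set Implicit Arguments. Unset Strict Implicit. Unset Printing Implicit Defensive.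
Import Order.TTheory GRing.Theory Num.Theory.
Local Open Scope classical_set_scope.
Local Open Scope ring_scope.

(** Write a point as m u1 + n u2 + z e3. In these coordinates the rotation r by
pi/3 about the z-axis is (m, n, z) |-> (- n, m + n, z), so 1 - r + r^2 kills
the horizontal plane and fixes the z-axis. Applied to a lattice vector it
yields its vertical part, hence a preserved lattice is the direct sum of its
horizontal and its vertical sublattice ([D6_split]). The vertical one is
cyclic, generated by some b e3, because a lattice meets a line in a discrete
group ([lattice_line_cyclic]).

For the horizontal part P, let s u1 generate the vectors of P on the line of
u1. Rotating, P contains H = s (Z u1 + Z u2). Conversely, for p in P the
difference of p and its mirror image in x = 0 is the lattice vector
2 <p, u1> u1, so 2 <p, u1>, and likewise 2 <p, u2>, lies in s Z. Those two
conditions cut out a lattice H' that contains H with index 3: explicitly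
H' = (s/3) H1, where H1 is generated by u1 + u2 and 2 u1 - u2. As 3 is prime,
P is H or H' ([D6_planar]), and the two cases give the two model lattices,
with a = s and a = s/3 respectively. *)

(** * Lattices as discrete subgroups *)

Section Lattices.
Variables (R : realType) (d : nat) (L : set 'rV[R]_3).
Hypothesis latL : is_lattice d L.

Lemma lattice_sub u v : L u -> L v -> L (u - v).
Proof.
have [b _ ->] := latL; move=> [p ->] [q ->].
exists [ffun i => p i - q i]; rewrite -sumrB; apply: eq_bigr => i _.
by rewrite ffunE mulrzBr.
Qed.

Lemma lattice_mulz u k : L u -> L (u *~ k).
Proof.
have [b _ ->] := latL; move=> [p ->].
exists [ffun i => p i * k]; rewrite mulrz_suml; apply: eq_bigr => i _.
by rewrite ffunE mulrzA.
Qed.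

Lemma lattice_opp u : L u -> L (- u).
Proof. by move=> Lu; rewrite -mulrN1z; exact: lattice_mulz. Qed.

Lemma lattice_add u v : L u -> L v -> L (u + v).
Proof. by move=> Lu /lattice_opp Lv; rewrite -[v]opprK; exact: lattice_sub. Qed.

(** A basis coordinate that is nonzero at [v] gives the scale [c]: coordinates
of lattice vectors are integers. This is the only discreteness that the
classification uses. *)
Lemma lattice_line_commensurable v : v != 0 -> (exists2 t, t != 0 & L (t *: v)) ->
  exists2 c : R, c != 0 & forall t, L (t *: v) -> exists n : int, t * c = n%:~R.
Proof.
move=> v0 [t0 t0N0 Lt0]; have [b fb LE] := latL.
have coordL u i : L u -> exists n : int, coord b i u = n%:~R.
  rewrite LE => -[p ->]; exists (p i).
  under eq_bigr do rewrite -scaler_int.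
  by rewrite (coord_sum_free (fun i => (p i)%:~R)).
have vb : v \in <<b>>%VS.
  move: Lt0; rewrite LE => -[p tvE].
  have -> : v = t0^-1 *: (t0 *: v) by rewrite scalerA mulVf ?scale1r.
  rewrite memvZ // tvE; apply: rpred_sum => i _; apply/rpredMz.
  by rewrite memv_span // mem_nth ?size_tuple.
have [i ciN0] : exists i, coord b i v != 0.
  apply: contrapT => /forallNP c0; move/eqP: v0; apply.
  rewrite (coord_span vb) big1 // => i _.
  by have /negP/negPn/eqP -> := c0 i; rewrite scale0r.
exists (coord b i v) => // t /(coordL _ i) [n tn]; exists n.
by rewrite -tn linearZ.
Qed.

(** The [t] with [t *: v] in the lattice form a subgroup of (1/c) Z, with [c]
from [lattice_line_commensurable]; Euclidean division by its least positive
element, up to the sign of [c], shows that this element generates it. *)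
Lemma lattice_line_cyclic v : v != 0 -> (exists2 t, t != 0 & L (t *: v)) ->
  exists2 s : R, s != 0 & forall t, L (t *: v) <-> exists k : int, t = s * k%:~R.
Proof.
move=> v0 Lt; have [c cN0 cP] := lattice_line_commensurable v0 Lt.
pose P (n : nat) := `[< (0 < n)%N /\ L ((n%:R / c) *: v) >].
have exP : exists n, P n.
  have [t tN0 Ltv] := Lt; have [n tn] := cP _ Ltv; exists `|n|%N; apply/asboolP.
  have nN0 : n != 0 by rewrite -(intr_eq0 R) -tn mulf_neq0.
  split; first by rewrite absz_gt0.
  have tE : t = n%:~R / c by rewrite -tn mulfK.
  rewrite natr_absz; have [n_ge0|n_lt0] := lerP 0 n.
    by rewrite ger0_norm // -tE.
  by rewrite ltr0_norm // rmorphN mulNr -tE scaleNr; exact: lattice_opp.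
have [d0 /asboolP[d0_gt0 Ld0] d0_min] := ex_minnP exP.
exists (d0%:R / c).
  by rewrite mulf_neq0 ?invr_eq0 // pnatr_eq0 -lt0n.
move=> t; split => [Ltv|[k ->]]; last first.
  by rewrite mulrC -scalerA scaler_int; exact: lattice_mulz.
have [n tn] := cP _ Ltv; exists (n %/ d0)%Z.
(* The remainder of n modulo d0 again gives a lattice vector, so it is 0. *)
have tE : t = n%:~R / c by rewrite -tn mulfK.
set q := (n %/ d0)%Z; set r := (n %% d0)%Z.
have d0N0 : d0%:Z != 0 by rewrite eqz_nat -lt0n.
have nE : n = q * d0%:Z + r by exact: divz_eq.
have r_ge0 : 0 <= r by exact: modz_ge0.
have r_lt : r < d0%:Z by rewrite -[ltRHS]gez0_abs //; exact: ltz_mod.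
have rE : t = (d0%:R / c) * q%:~R + `|r|%N%:R / c.
  by rewrite tE natr_absz ger0_norm // {1}nE rmorphD rmorphM /= -pmulrn; ring.
have Lr : L ((`|r|%N%:R / c) *: v).
  have -> : (`|r|%N%:R / c) *: v = t *: v - ((d0%:R / c) *: v) *~ q.
    by rewrite -scaler_int scalerA -scalerBl rE; congr (_ *: _); ring.
  by apply: lattice_sub => //; exact: lattice_mulz.
have [r0|rN0] := eqVneq r 0; first by rewrite rE r0 mul0r addr0.
have : (d0 <= `|r|)%N by apply: d0_min; apply/asboolP; split; rewrite ?absz_gt0.
by lia.
Qed.

End Lattices.

(** Otherwise the basis, which has full rank, would span a space inside a
coordinate plane. *)
Lemma full_lattice_coord_neq0 (R : realType) (L : set 'rV[R]_3) j :
  is_lattice 3 L -> exists2 v, L v & v 0 j != 0.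
Proof.
move=> [b fb ->]; apply: contrapT => NL.
have b0 (i : 'I_3) : b`_i 0 j = 0.
  apply: contrapT => /eqP bij; apply: NL; exists b`_i => //.
  exists [ffun k => (k == i)%:R]; rewrite (bigD1 i) //= big1 ?addr0.
    by rewrite ffunE eqxx.
  by move=> k /negPf ki; rewrite ffunE ki mulr0z.
have bfull : <<b>>%VS = fullv.
  apply/eqP; rewrite eqEdim subvf /= dimvf /dim /= mul1n.
  by move: fb; rewrite /free size_tuple => /eqP ->.
have : (delta_mx 0 j : 'rV[R]_3) \in <<b>>%VS by rewrite bfull memvf.
move/coord_span/(congr1 (fun v : 'rV[R]_3 => v 0 j)).
rewrite summxE big1 => [|i _]; last by rewrite mxE b0 mulr0.
by rewrite mxE !eqxx => /eqP; rewrite oner_eq0.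
Qed.

(** * Hexagonal coordinates *)

Section HexCoordinates.
Variable R : realType.
Implicit Types m n x y z : R.

(** Coordinates adapted to the sixfold symmetry: in the basis u1, u2, e3 the
group acts by integer matrices, and the model lattices have integer
coordinates. *)
Definition hexvec m n z : 'rV[R]_3 := m *: u1 R + n *: u2 R + z *: e3 R.

Lemma hexvecE m n z : hexvec m n z = vec3 (m + n / 2) (n * (Num.sqrt 3 / 2)) z.
Proof.
by apply/rowP => -[[|[|[|//]]] ?]; rewrite /hexvec /u1 /u2 !mxE /=; ring.
Qed.

Lemma sqrt3_half_neq0 : Num.sqrt 3 / 2 != 0 :> R.
Proof. by rewrite lt0r_neq0 // divr_gt0 // sqrtr_gt0. Qed.

Lemma hexvecP (v : 'rV[R]_3) : exists m n z, v = hexvec m n z.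
Proof.
have s3 := sqrt3_half_neq0.
pose n := v 0 1 / (Num.sqrt 3 / 2).
exists (v 0 0 - n / 2), n, (v 0 (inord 2)); rewrite hexvecE.
apply/rowP => -[[|[|[|//]]] ?]; rewrite !mxE /= /n.
- by rewrite subrK; congr (fun_of_matrix v _ _); apply: val_inj.
- by rewrite divfK //; congr (fun_of_matrix v _ _); apply: val_inj.
- by congr (fun_of_matrix v _ _); apply: val_inj; rewrite /= inordK.
Qed.

Lemma hexvecB m n z m' n' z' :
  hexvec m n z - hexvec m' n' z' = hexvec (m - m') (n - n') (z - z').
Proof. by rewrite /hexvec; apply/rowP => i; rewrite !mxE; ring. Qed.

Lemma hexvecD m n z m' n' z' :
  hexvec m n z + hexvec m' n' z' = hexvec (m + m') (n + n') (z + z').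
Proof. by rewrite /hexvec; apply/rowP => i; rewrite !mxE; ring. Qed.

Lemma hexvecMz m n z (k : int) :
  hexvec m n z *~ k = hexvec (m * k%:~R) (n * k%:~R) (z * k%:~R).
Proof.
by rewrite -scaler_int /hexvec; apply/rowP => i; rewrite !mxE; ring.
Qed.

Lemma hexvec_diag3 m n z a b :
  hexvec m n z *m diag3 a a b = hexvec (m * a) (n * a) (z * b).
Proof.
rewrite !hexvecE; apply/rowP => i; rewrite mul_mx_diag !mxE.
by case: i => -[|[|[|//]]] ? /=; ring.
Qed.

Lemma diag3_unit (a b : R) : a != 0 -> b != 0 -> diag3 a a b \in unitmx.
Proof.
move=> a0 b0; rewrite unitmxE det_diag !big_ord_recr big_ord0 /= !mxE /=.
by rewrite mul1r unitfE !mulf_neq0.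
Qed.

(** With t = pi/6 one has 2 t = pi/2 - t, so sin (2 t) = cos t, that is
2 sin t cos t = cos t. *)
Lemma sin_cos_pi6 : sin (pi / 6) = 2^-1 :> R /\ cos (pi / 6) = Num.sqrt 3 / 2 :> R.
Proof.
set t : R := pi / 6.
have tpi : t + t = pi / 2 - t by rewrite /t; field.
have pi0 : 0 < pi :> R := pi_gt0 R.
have c_gt0 : 0 < cos t.
  by apply: cos_gt0_pihalf; rewrite /t; apply/andP; split; lra.
have cE : cos t = 2 * sin t * cos t.
  have -> : 2 * sin t * cos t = sin (t + t) by rewrite sinD; ring.
  by rewrite tpi -[in RHS]opprB sinN sinBpihalf opprK.
have sE : sin t = 2^-1.
  have : 2 * sin t = 1 by apply: (mulIf (lt0r_neq0 c_gt0)); rewrite mul1r -cE.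
  by lra.
split => //; apply/eqP; rewrite -(@eqrXn2 _ 2) ?divr_ge0 ?sqrtr_ge0 ?(ltW c_gt0) //.
rewrite expr_div_n sqr_sqrtr // -[cos t ^+ 2](addrK (sin t ^+ 2)) cos2Dsin2 sE.
by apply/eqP; field.
Qed.

Lemma mul_reflection (u v : 'rV[R]_3) :
  u *m reflection v = u - (2 / (v *m v^T) 0 0 * (u *m v^T) 0 0) *: v.
Proof.
rewrite /reflection mulmxBr mulmx1 -scalemxAr mulmxA.
by rewrite {1}[u *m v^T]mx11_scalar mul_scalar_mx scalerA.
Qed.

Lemma dot_vec3 x y z x' y' z' :
  (vec3 x y z *m (vec3 x' y' z')^T) 0 0 = x * x' + y * y' + z * z'.
Proof. by rewrite !mxE !big_ord_recr big_ord0 /= !mxE /= add0r. Qed.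

Lemma hexvec_reflection_e1 m n z :
  hexvec m n z *m reflection (e1 R) = hexvec (- m - n) n z.
Proof.
rewrite mul_reflection !hexvecE !dot_vec3.
by apply/rowP => -[[|[|[|//]]] ?]; rewrite !mxE /=; field.
Qed.

Lemma hexvec_reflection_pi6 m n z :
  hexvec m n z *m reflection (vec3 (cos (pi / 6)) (sin (pi / 6)) 0) =
  hexvec (- n) (- m) z.
Proof.
have [-> ->] := sin_cos_pi6.
have w2 : Num.sqrt 3 * Num.sqrt 3 = 3 :> R by rewrite -expr2 sqr_sqrtr.
rewrite mul_reflection !hexvecE !dot_vec3.
set w := Num.sqrt 3 in w2 *.
have -> : w / 2 * (w / 2) + 2^-1 * 2^-1 + 0 * 0 = 1.
  have -> : w / 2 * (w / 2) = (w * w) / 4 by field.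
  by rewrite w2; field.
apply/rowP => -[[|[|[|//]]] ?]; rewrite !mxE /=; last by field.
- transitivity (m + n / 2 - (m + n) / 2 * (w * w)); first by field.
  by rewrite w2; field.
- by field.
Qed.

End HexCoordinates.

(** * The hexagonal lattices with symmetric group *)

Section Sixfold.
Variables (R : realType) (L : set 'rV[R]_3).
Hypotheses (latL : is_lattice 3 L) (symL : preserved_by L (D6tilde R)).

Lemma D6_mirror_e1 m n z : L (hexvec m n z) -> L (hexvec (- m - n) n z).
Proof.
move=> Lv; rewrite -hexvec_reflection_e1.
rewrite -(symL (g := reflection (e1 R))); first by exists (hexvec m n z).
by apply: generated_in; left.
Qed.

Lemma D6_mirror_pi6 m n z : L (hexvec m n z) -> L (hexvec (- n) (- m) z).
Proof.
move=> Lv; rewrite -hexvec_reflection_pi6.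
rewrite -(symL (g := reflection (vec3 (cos (pi / 6)) (sin (pi / 6)) 0))).
  by exists (hexvec m n z).
by apply: generated_in; right.
Qed.

(** The rotation by pi/3 is the product of the two generating mirrors. *)
Lemma D6_rotation m n z : L (hexvec m n z) -> L (hexvec (- n) (m + n) z).
Proof.
by move=> /D6_mirror_e1/D6_mirror_pi6; congr (L (hexvec _ _ _)); ring.
Qed.

(** If r is the rotation by pi/3, then 1 - r + r^2 is the projection to the
z-axis: on the plane r is a root of X^2 - X + 1, and on the axis r = 1. *)
Lemma D6_axial m n z : L (hexvec m n z) -> L (hexvec 0 0 z).
Proof.
move=> Lv; have Lrv := D6_rotation Lv.
have := lattice_add latL (lattice_sub latL Lv Lrv) (D6_rotation Lrv).
by rewrite hexvecB hexvecD; congr (L (hexvec _ _ _)); ring.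
Qed.

Lemma D6_split m n z :
  L (hexvec m n z) <-> L (hexvec m n 0) /\ L (hexvec 0 0 z).
Proof.
split=> [Lv|[Lp La]]; last first.
  by have := lattice_add latL Lp La; rewrite hexvecD !addr0 add0r.
have La := D6_axial Lv; split => //.
by have := lattice_sub latL Lv La; rewrite hexvecB !subr0 subrr.
Qed.

(** These are 2 <p, u1> u1 and 2 <p, u2> u1 for p = m u1 + n u2. The first
is p minus its image in the plane x = 0; the second follows since the other
generating mirror exchanges u1 and - u2. *)
Lemma D6_projections m n : L (hexvec m n 0) ->
  L (hexvec (2 * m + n) 0 0) /\ L (hexvec (m + 2 * n) 0 0).
Proof.
have twice x y : L (hexvec x y 0) -> L (hexvec (2 * x + y) 0 0).
  move=> Lv; have := lattice_sub latL Lv (D6_mirror_e1 Lv).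
  by rewrite hexvecB; congr (L (hexvec _ _ _)); ring.
move=> Lv; split; first exact: twice.
have /twice/(lattice_opp latL) := D6_mirror_pi6 Lv.
by rewrite -mulrN1z hexvecMz; congr (L (hexvec _ _ _)); ring.
Qed.

Lemma D6_axial_cyclic :
  exists2 b : R, b != 0 & forall z, L (hexvec 0 0 z) <-> exists k : int, z = b * k%:~R.
Proof.
have hE z : hexvec 0 0 z = z *: e3 R by rewrite /hexvec !scale0r !add0r.
have e3N0 : e3 R != 0.
  by apply/eqP => /rowP/(_ (inord 2)); rewrite !mxE inordK //= => /eqP; rewrite oner_eq0.
have [|s sN0 sP] := lattice_line_cyclic latL e3N0.
  have [v Lv v2] := full_lattice_coord_neq0 (inord 2) latL.
  have [m [n [z vE]]] := hexvecP v; exists z; last first.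
    by rewrite -hE; apply: (@D6_axial m n); rewrite -vE.
  by move: v2; rewrite vE hexvecE !mxE inordK.
by exists s => // z; rewrite hE.
Qed.

Lemma D6_e1_cyclic :
  exists2 s : R, s != 0 & forall t, L (hexvec t 0 0) <-> exists k : int, t = s * k%:~R.
Proof.
have hE t : hexvec t 0 0 = t *: u1 R by rewrite /hexvec !scale0r !addr0.
have u1N0 : u1 R != 0.
  by apply/eqP => /rowP/(_ 0); rewrite !mxE /= => /eqP; rewrite oner_eq0.
have [|s sN0 sP] := lattice_line_cyclic latL u1N0.
  have [v Lv v0] := full_lattice_coord_neq0 0 latL.
  have [m [n [z vE]]] := hexvecP v; exists (2 * m + n).
    move: v0; rewrite vE hexvecE !mxE /=; apply: contra_neq => mn0.
    by lra.
  rewrite -hE; apply: (D6_projections _).1.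
  by move: Lv; rewrite vE => /D6_split[].
by exists s => // t; rewrite hE.
Qed.

(** The horizontal sublattice P satisfies H <= P <= H', with H = s (Z u1 + Z u2)
and H' of index 3 over H. If P is not inside H, a vector of P outside H
generates H' modulo H. *)
Lemma D6_planar :
  exists2 a : R, a != 0 &
  (forall m n, L (hexvec m n 0) <->
     exists i j : int, m = a * i%:~R /\ n = a * j%:~R) \/
  (forall m n, L (hexvec m n 0) <->
     exists i j : int, m = a * (i + 2 * j)%:~R /\ n = a * (i - j)%:~R).
Proof.
have [s sN0 sP] := D6_e1_cyclic.
have Ls1 : L (hexvec s 0 0) by apply/sP; exists 1; rewrite mulr1.
have Ls2 : L (hexvec 0 s 0).
  by have := D6_rotation Ls1; rewrite oppr0 addr0.
have Lcomb m n m' n' (i j : int) : L (hexvec m n 0) -> L (hexvec m' n' 0) ->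
    L (hexvec (m * i%:~R + m' * j%:~R) (n * i%:~R + n' * j%:~R) 0).
  move=> /(lattice_mulz latL i) Lv /(lattice_mulz latL j) Lv'.
  have := lattice_add latL Lv Lv'.
  by rewrite !hexvecMz hexvecD !mul0r addr0.
have LsZ (i j : int) : L (hexvec (s * i%:~R) (s * j%:~R) 0).
  by have := Lcomb _ _ _ _ i j Ls1 Ls2; rewrite !mul0r addr0 add0r.
(* P is inside H': solve 2 m + n = s k and m + 2 n = s l for m and n. *)
have thirds m n : L (hexvec m n 0) -> exists k l : int,
    m = s / 3 * (2 * k - l)%:~R /\ n = s / 3 * (2 * l - k)%:~R.
  move=> /D6_projections[/sP[k kE] /sP[l lE]]; exists k, l.
  split.
    transitivity ((2 * (2 * m + n) - (m + 2 * n)) / 3); first by field.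
    by rewrite kE lE rmorphB rmorphM /=; field.
  transitivity ((2 * (m + 2 * n) - (2 * m + n)) / 3); first by field.
  by rewrite kE lE rmorphB rmorphM /=; field.
have [sZ|/existsNP[m /existsNP[n]]] := pselect (forall m n, L (hexvec m n 0) ->
    exists i j : int, m = s * i%:~R /\ n = s * j%:~R).
  by exists s => //; left => m n; split=> [/sZ //|[i [j [-> ->]]]]; exact: LsZ.
move=> /not_implyP[Lmn NsZ].
(* The vector (s/3) (u1 + u2), which generates H' modulo H, lies in P. *)
have Lc : L (hexvec (s / 3) (s / 3) 0).
  have [k [l [mE nE]]] := thirds _ _ Lmn.
  (* 2 k - l and 2 l - k are both congruent to - (k + l) modulo 3, so the vector
     (m, n) is (s/3) (e, e) modulo H; e = 0 would put it in H. *)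
  have [a [b [e [kE lE e12]]]] : exists a b e : int,
      [/\ 2 * k - l = 3 * a + e, 2 * l - k = 3 * b + e & [\/ e = 0, e = 1 | e = 2]].
    exists ((2 * k - l) %/ 3)%Z, ((2 * l - k) %/ 3)%Z, ((2 * k - l) %% 3)%Z.
    split; [lia|lia|].
    have := modz_ge0 (2 * k - l) (isT : 3 != 0 :> int).
    have := ltz_pmod (2 * k - l) (isT : 0 < 3 :> int).
    set r := (_ %% _)%Z => ? ?.
    have [->|[->|->]] : r = 0 \/ (r = 1 \/ r = 2) by lia.
    - exact: Or31.
    - exact: Or32.
    - exact: Or33.
  rewrite kE rmorphD rmorphM /= in mE; rewrite lE rmorphD rmorphM /= in nE.
  case: e12 => eE; rewrite eE in mE nE.
  - by exfalso; apply: NsZ; exists a, b; rewrite mE nE; split; field.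
  - have := lattice_sub latL Lmn (LsZ a b).
    by rewrite hexvecB mE nE; congr (L (hexvec _ _ _)); field.
  - have := lattice_sub latL (LsZ (a + 1) (b + 1)) Lmn.
    by rewrite hexvecB mE nE !rmorphD /=; congr (L (hexvec _ _ _)); field.
exists (s / 3); first by rewrite mulf_neq0 ?invr_eq0 ?pnatr_eq0.
right=> x y; split=> [/thirds[k [l [-> ->]]]|[i [j [-> ->]]]].
  by exists l, (k - l); split; congr (_ * _%:~R); ring.
(* (i + 2 j, i - j) = (i - j) (1, 1) + j (3, 0), in units of s/3. *)
have := Lcomb _ _ _ _ (i - j) j Lc Ls1.
by rewrite !(rmorphB, rmorphD, rmorphM) /=; congr (L (hexvec _ _ _)); field.
Qed.

End Sixfold.

(** * Comparison with the model lattices *)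

Section Models.
Variable R : realType.

Lemma intspan2_oplusP (p q w v : 'rV[R]_3) :
  lattice_oplus (intspan [tuple p; q]) w v <->
  exists i j k : int, v = p *~ i + q *~ j + w *~ k.
Proof.
split=> [[k _ [_ [c ->] <-]]|[i [j [k ->]]]].
  by exists (c ord0), (c (lift ord0 ord0)), k; rewrite !big_ord_recl big_ord0 addr0.
exists k => //; exists (p *~ i + q *~ j) => //.
exists [ffun x : 'I_2 => if x == 0 then i else j].
by rewrite !big_ord_recl big_ord0 addr0 !ffunE.
Qed.

Lemma hexvec_inj (m n z m' n' z' : R) : hexvec m n z = hexvec m' n' z' ->
  [/\ m = m', n = n' & z = z'].
Proof.
have s3 := sqrt3_half_neq0 R.
rewrite !hexvecE => E.
have := congr1 (fun v : 'rV[R]_3 => v 0 (inord 2)) E.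
have := congr1 (fun v : 'rV[R]_3 => v 0 1) E.
have := congr1 (fun v : 'rV[R]_3 => v 0 0) E.
rewrite !mxE inordK //= => mE /(mulIf s3) nE ->.
by split => //; move: mE; rewrite nE => /addIr.
Qed.

Lemma hex10_oplusP (m n z : R) :
  lattice_oplus (Lambda36_10 R) (e3 R) (hexvec m n z) <->
  (exists i j : int, m = i%:~R /\ n = j%:~R) /\ (exists k : int, z = k%:~R).
Proof.
have E (i j k : int) : u1 R *~ i + u2 R *~ j + e3 R *~ k = hexvec i%:~R j%:~R k%:~R.
  by rewrite -!scaler_int.
rewrite intspan2_oplusP; split=> [[i [j [k]]]|[[i [j [-> ->]]] [k ->]]].
  by rewrite E => /hexvec_inj[-> -> ->]; split; [exists i, j|exists k].
by exists i, j, k; rewrite E.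
Qed.

Lemma hex11_oplusP (m n z : R) :
  lattice_oplus (Lambda36_11 R) (e3 R) (hexvec m n z) <->
  (exists i j : int, m = (i + 2 * j)%:~R /\ n = (i - j)%:~R) /\
  (exists k : int, z = k%:~R).
Proof.
have E (i j k : int) : (u1 R + u2 R) *~ i + (2 *: u1 R - u2 R) *~ j + e3 R *~ k =
    hexvec (i + 2 * j)%:~R (i - j)%:~R k%:~R.
  rewrite -!scaler_int /hexvec !(rmorphD, rmorphB, rmorphM) /=.
  by apply/rowP => x; rewrite !mxE; ring.
rewrite intspan2_oplusP; split=> [[i [j [k]]]|[[i [j [-> ->]]] [k ->]]].
  by rewrite E => /hexvec_inj[-> -> ->]; split; [exists i, j|exists k].
by exists i, j, k; rewrite E.
Qed.

Lemma lattice_map_invmx (L : set 'rV[R]_3) (D : 'M[R]_3) v :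
  D \in unitmx -> lattice_map L (invmx D) v <-> L (v *m D).
Proof.
move=> Du; split=> [[w Lw <-]|LvD]; first by rewrite mulmxKV.
by exists (v *m D) => //; rewrite mulmxK.
Qed.

End Models.

Theorem lemma4p8 (R : realType) (L : set 'rV[R]_3) :
  is_lattice 3 L ->
  preserved_by L (D6tilde R) ->
  exists a b : R,
    diag3 a a b \in unitmx /\
    [set lattice_oplus (Lambda36_10 R) (e3 R);
         lattice_oplus (Lambda36_11 R) (e3 R)]
      (lattice_map L (invmx (diag3 a a b))).
Proof.
move=> latL symL.
have [b bN0 bP] := D6_axial_cyclic latL symL.
have [a aN0 aP] := D6_planar latL symL.
have Du := diag3_unit aN0 bN0.
have scale_iff (c x y : R) : c != 0 -> x * c = c * y <-> x = y.
  by move=> c0; split=> [|->]; [rewrite mulrC => /(mulfI c0)|rewrite mulrC].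
have axialE z : (exists k : int, z * b = b * k%:~R) <-> (exists k : int, z = k%:~R).
  by split=> -[k /(scale_iff _ _ _ bN0) kE]; exists k.
exists a, b; split => //.
case: aP => aP; [left|right]; apply/seteqP; split => v;
  have [m [n [z ->]]] := hexvecP v.
all: rewrite /= ?(hex10_oplusP, hex11_oplusP) lattice_map_invmx // hexvec_diag3.
all: rewrite D6_split // bP axialE aP.
all: by move=> [[i [j [/(scale_iff _ _ _ aN0) mE /(scale_iff _ _ _ aN0) nE]]] ?];
  split=> //; exists i, j.
Qed.
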